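(* Let $j\ge 2$ and $t\ge 2$ be integers, and let $G$ be a $j$-connected $K_{1,t}$-free graph. Then there exist an integer $m \ge 0$ and a sequence of subgraphs $F_0, F_1, \dots, F_m$ of $G$ such that $F_0$ is a cycle with $|V(F_0)| \geq j$; each $F_{\ell}$ with $1 \leq \ell \leq m$ is a $j$-spider from a vertex in $G - \bigcup_{i=0}^{\ell-1} V(F_{i})$ to the vertex set $\bigcup_{i=0}^{\ell-1} V(F_{i})$; $V(G)=\bigcup_{i=0}^{m}V(F_i)$; and every vertex $v$ of $G$ satisfies the following two properties: (1) If $j \geq 3$ and there exists a $j$-spider $F_{\ell}$ (with $1 \leq \ell \leq m$) whose branch is $v$, then $v$ is a foot of none of $F_0, F_1, \dots, F_m$. (2) If $j=2$ or there exists no $j$-spider $F_{\ell}$ (with $1 \leq \ell \leq m$) whose branch is $v$, then $v$ is a foot of at most $t-2$ of $F_0, F_1, \dots, F_m$.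
   Context: All graphs are finite, simple and undirected. A graph is $j$-connected if it has more than $j$ vertices and no deletion of fewer than $j$ vertices disconnects it. A graph is $K_{1,t}$-free if it contains no induced subgraph isomorphic to the complete bipartite graph $K_{1,t}$. For $S\subseteq V(G)$, $G-S$ is the graph obtained from $G$ by deleting the vertices of $S$ and all edges incident with them. A spider is a tree having at most one vertex of degree greater than two. The vertex of degree greater than two is called its branch if it exists; otherwise any vertex of degree two can be regarded as its branch. A leaf of a spider is called a foot. For an integer $j\ge 2$, a $j$-spider is a spider with exactly $j$ feet; equivalently, it is a spider whose branch has degree exactly $j$, i.e. a subdivision of $K_{1,j}$ (for $j=2$, a path of length at least $2$). For a vertex $v$ and a vertex subset $X$ of a graph with $v\notin X$ and $|X|\ge j$, a $j$-spider from $v$ to $X$ is a $j$-spider (contained as a subgraph in the graph) in which $v$ is the branch, all $j$ (pairwise distinct) feet are contained in $X$, and no other vertices of the spider belong to $X$. The cycle $F_0$ has no feet (and no branch). *)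

(* Defs.v *)
From mathcomp Require Import all_boot.

Set Implicit Arguments.
Unset Strict Implicit.
Unset Printing Implicit Defensive.

Record graph := Graph {
  vertex :> finType;
  adj : rel vertex;
  adj_sym : symmetric adj;
  adj_irrefl : irreflexive adj
}.

Definition bip_adj (a b : nat) : rel ('I_a + 'I_b)%type :=
  fun x y => match x, y with
             | inl _, inr _ | inr _, inl _ => true
             | _, _ => false
             end.

Lemma bip_adj_sym a b : symmetric (@bip_adj a b).
Proof. by case=> x [] y. Qed.

Lemma bip_adj_irrefl a b : irreflexive (@bip_adj a b).
Proof. by case. Qed.

Definition complete_bipartite (a b : nat) : graph :=
  Graph (@bip_adj_sym a b) (@bip_adj_irrefl a b).

Definition has_induced (H G : graph) : Prop :=
  exists2 f : H -> G, injective f & forall x y, adj (f x) (f y) = adj x y.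

Definition star_free (t : nat) (G : graph) : Prop :=
  ~ has_induced (complete_bipartite 1 t) G.

Record subgraph (G : graph) := Subgraph {
  svert : {set G};
  sedge : rel G;
  sedge_sym : symmetric sedge;
  sedge_sub : forall x y, sedge x y -> [&& x \in svert, y \in svert & adj x y]
}.

Section Deletion.
Variables (G : graph) (S : {set G}).

Definition del_edge : rel G :=
  fun x y => [&& x \in ~: S, y \in ~: S & adj x y].

Lemma del_edge_sym : symmetric del_edge.
Proof. by move=> x y; rewrite /del_edge adj_sym andbCA. Qed.

Lemma del_edge_sub x y :
  del_edge x y -> [&& x \in ~: S, y \in ~: S & adj x y].
Proof. by []. Qed.

Definition del_verts : subgraph G := Subgraph del_edge_sym del_edge_sub.

End Deletion.

Section Subgraphs.
Variables (G : graph) (H : subgraph G).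

Definition sconnected : Prop :=
  svert H != set0 /\ {in svert H &, forall x y, connect (sedge H) x y}.

(* [ucycle] also accepts closed walks x, y, x along a single edge, which have
   size 2; graph cycles are those of size at least 3. *)
Definition acyclic : Prop :=
  forall c : seq G, ucycle (sedge H) c -> size c <= 2.

Definition is_tree : Prop := sconnected /\ acyclic.

Definition is_cycle : Prop :=
  exists c : seq G,
    [/\ 2 < size c, uniq c, svert H = [set x in c]
      & forall x y, sedge H x y =
          (x \in c) && (y == next c x) || (y \in c) && (x == next c y)].

Definition degree (v : G) : nat := #|[set u | sedge H v u]|.

Definition feet : {set G} := [set v | degree v == 1].

Definition is_spider : Prop :=
  is_tree /\ #|[set v | 2 < degree v]| <= 1.

Definition is_branch (v : G) : bool :=
  if [exists u, 2 < degree u] then 2 < degree v else degree v == 2.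

(* Requiring a branch excludes the single edge for j = 2: it has two feet, but
   a 2-spider is a path of length at least 2. *)
Definition is_jspider (j : nat) : Prop :=
  [/\ is_spider, #|feet| = j & exists v, is_branch v].

Definition spider_from (j : nat) (v : G) (X : {set G}) : Prop :=
  [/\ v \notin X, j <= #|X|, is_jspider j & is_branch v] /\
  (feet \subset X /\ svert H :&: X \subset feet).

End Subgraphs.

Definition j_connected (j : nat) (G : graph) : Prop :=
  j < #|G| /\ forall S : {set G}, #|S| < j -> sconnected (del_verts S).

(* Main.v *)
Require Import Defs.
From mathcomp Require Import all_boot.
From mathcomp Require Import zify.
From Stdlib Require Import Classical.

(** The decomposition is built greedily. [F 0] is a longest cycle, and each
spider is a largest one, in number of vertices, among those with a suitably
chosen branch and with feet off the earlier branches. Write X for the set of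
vertices covered so far and R for the set of branches used so far.

Feet at a vertex. Maximality makes it impossible to reroute an edge xy of [F i]
through a vertex u that is not covered by [F 0], ..., [F i]: such a u is not
adjacent to both x and y. Let v be covered for the first time by [F i0], and
consider one neighbour of v in [F i0] together with the neighbour of v in every
spider of which v is a foot. The neighbour in a later subgraph is always a
vertex not covered before, so these neighbours are distinct and pairwise
nonadjacent, and with v they induce a star. Hence there are at most t - 1 of
them, and v is a foot of at most t - 2 spiders ([foot_count]). This bound holds
for every vertex.

Branches are never feet. The construction maintains the invariant [linked]:
every nonempty set B disjoint from X has at least j neighbours outside R. By
Hall's theorem the invariant provides, for every v outside X, a spider from v
with its j feet in X minus R ([fan_exists]): match j copies of v and every
other uncovered vertex x injectively to a successor, where x may be its own
successor; following successors from v gives the legs.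

The choice of the branch v preserves the invariant ([tight_root]). Call B tight
if it has exactly j neighbours outside R, and take v in a minimal tight set B,
or anywhere outside X if no set is tight. The j legs leave B through different
neighbours, so the spider covers all neighbours of B outside R. If the
invariant failed afterwards, there would be a tight set C that avoids the
spider and has v as a neighbour. A vertex of C adjacent to v cannot be among
the covered neighbours of B, so it lies in B. Thus B and C meet, and
submodularity of the number of neighbours makes their intersection tight. This
contradicts the minimality of B, since v is in B but not in C.

A longest cycle has at least j vertices because all degrees are at least j, and
the invariant holds for it, with R empty, because G is j-connected. *)

Set Implicit Arguments.
Unset Strict Implicit.

(** * Maximal sets and Hall's theorem *)

Lemma ex_max_card (T : finType) (P : {set T} -> Prop) (A0 : {set T}) :
  P A0 -> exists2 A, P A & forall B, P B -> #|B| <= #|A|.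
Proof.
have [n] := ubnP (#|T| - #|A0|); elim: n A0 => // n IHn A0 ltn PA0.
have [[B [PB ltB]]|noB] := classic (exists B, P B /\ #|A0| < #|B|).
  by apply: (IHn B) => //; have := max_card B; lia.
exists A0 => // B PB; rewrite leqNgt; apply/negP => ltB.
by apply: noB; exists B.
Qed.

(** Hall's marriage theorem, by Rado's argument: as long as some A i has two
elements, one of them can be deleted without destroying Hall's condition. The
element [x0] only supplies values outside [D]. *)
Lemma hall (I T : finType) (x0 : T) (D : {set I}) (A : I -> {set T}) :
    (forall J : {set I}, J \subset D -> #|J| <= #|\bigcup_(i in J) A i|) ->
  exists f : I -> T, (forall i, i \in D -> f i \in A i) /\ {in D &, injective f}.
Proof.
have [n] := ubnP (\sum_(i in D) #|A i|).
elim: n A => // n IHn A ltn hallA.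
have A_gt0 i : i \in D -> 0 < #|A i|.
  by move=> Di; have := hallA [set i]; rewrite sub1set cards1 big_set1; apply.
have [/existsP[i /andP[Di]]|small] :=
    boolP [exists i, (i \in D) && (1 < #|A i|)]; last first.
  have A1 i : i \in D -> #|A i| = 1.
    move=> Di; move/existsPn: small => /(_ i); have := A_gt0 i Di.
    rewrite Di /=; lia.
  pose f i := odflt x0 [pick x in A i].
  have Af i : i \in D -> A i = [set f i].
    move=> Di; have /eqP/cards1P[y Ay] := A1 i Di.
    rewrite /f; case: pickP => [x|/(_ y)]; rewrite Ay inE ?eqxx //.
    by move/eqP->.
  exists f; split=> [i Di|i k Di Dk eqf]; first by rewrite Af ?inE.
  apply/eqP/negPn/negP => neq_ik.
  have := hallA [set i; k]; rewrite subUset !sub1set Di Dk => /(_ isT).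
  by rewrite cards2 neq_ik bigcup_setU !big_set1 !Af // eqf setUid cards1.
case/card_gt1P=> x [y [Ax Ay neq_xy]].
(* A' z deletes z from A i. If both A' x and A' y violate Hall's condition, the
   two violating families contradict the submodularity of unions. *)
pose A' z k := if k == i then A i :\ z else A k.
pose bad z := [exists J : {set I}, (J \subset D) && (#|\bigcup_(k in J) A' z k| < #|J|)].
have step z : z \in A i -> ~~ bad z ->
  exists f : I -> T, (forall i, i \in D -> f i \in A i) /\ {in D &, injective f}.
  move=> Az /existsPn nbad; have [||f [fA f_inj]] := IHn (A' z).
  - move: ltn; rewrite ltnS; apply: leq_trans.
    rewrite (bigD1 i) //= [X in _ < X](bigD1 i) //= /A' eqxx.
    rewrite [#|A i|](cardsD1 z) Az add1n addSn ltnS leq_add2l.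
    by apply: leq_sum => k /andP[_ /negPf->].
  - by move=> J JD; have := nbad J; rewrite JD /= -leqNgt.
  exists f; split=> // k Dk; have := fA k Dk; rewrite /A'.
  by case: eqP => // ->; case/setD1P.
have [badx|] := boolP (bad x); last exact: step.
have [bady|] := boolP (bad y); last exact: step.
have unbad z : bad z -> exists J : {set I}, [/\ i \in J, J \subset D &
    #|\bigcup_(k in J :\ i) A k :|: A i :\ z| < #|J|].
  case/existsP=> J /andP[JD ltJ]; have [Ji|nJi] := boolP (i \in J).
    exists J; split=> //; move: ltJ; rewrite (big_setD1 i) //= /A' eqxx setUC.
    suff -> : \bigcup_(k in J :\ i) A k =
      \bigcup_(k in J :\ i) (if k == i then A i :\ z else A k) by [].
    by apply: eq_bigr => k /setD1P[/negPf->].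
  move: ltJ; rewrite ltnNge => /negP[]; apply: leq_trans (hallA J JD) _.
  apply/eq_leq/congr1/congr1/congr1; apply: eq_bigr => k Jk; rewrite /A'.
  by case: eqP => // ki; rewrite -ki Jk in nJi.
have [J1 [J1i J1D lt1]] := unbad x badx; have [J2 [J2i J2D lt2]] := unbad y bady.
set U1 := (_ :|: _) in lt1; set U2 := (_ :|: _) in lt2.
have leU : #|J1 :|: J2| <= #|U1 :|: U2|.
  apply: leq_trans (hallA _ _) (subset_leq_card _); first by rewrite subUset J1D.
  apply/subsetP=> z /bigcupP[k Jk Az]; have [ki|ki] := eqVneq k i.
    rewrite ki in Az; rewrite !inE Az !andbT.
    have [->|/=] := eqVneq z x; last by rewrite orbT.
    by rewrite neq_xy !orbT.
  case/setUP: Jk => Jk; rewrite !inE; apply/orP; [left|right]; apply/orP; left;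
    by apply/bigcupP; exists k; rewrite // !inE ki.
have leI : #|(J1 :&: J2) :\ i| <= #|U1 :&: U2|.
  apply: leq_trans (hallA _ _) (subset_leq_card _).
    by apply/subsetP=> k /setD1P[_ /setIP[/(subsetP J1D)]].
  apply/subsetP=> z /bigcupP[k /setD1P[ki /setIP[J1k J2k]] Az].
  by rewrite !inE; apply/andP; split; apply/orP; left; apply/bigcupP; exists k;
    rewrite // !inE ki.
have := cardsUI U1 U2; have := cardsUI J1 J2.
have := cardsD1 i (J1 :&: J2); rewrite inE J1i J2i /=.
by move: lt1 lt2 leU leI; clear; lia.
Qed.

(** * Neighbourhoods and the linkage invariant *)

(** The neighbours of [B] that lie neither in [B] nor in [R]. *)
Definition nbhd {G : graph} (R B : {set G}) : {set G} :=
  [set x | [&& x \notin B, x \notin R & [exists b in B, adj b x]]].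

Lemma nbhd_submod {G : graph} (R B C : {set G}) :
  #|nbhd R (B :&: C)| + #|nbhd R (B :|: C)| <= #|nbhd R B| + #|nbhd R C|.
Proof.
rewrite -(cardsUI (nbhd R B)) -cardsUI leq_add //; apply: subset_leq_card.
  apply/subsetP=> x; rewrite !inE negb_and negb_or.
  case/orP=> /and3P[nx -> /existsP[b /andP[Bb ax]]];
    move: Bb nx; rewrite !inE.
    by case/andP=> Bb Cb /orP[] nx; apply/orP; [left|right];
      rewrite nx; apply/existsP; exists b; rewrite ?Bb ?Cb.
  by case/orP=> Bb /andP[nB nC]; apply/orP; [left|right];
      rewrite ?nB ?nC; apply/existsP; exists b; rewrite Bb.
apply/subsetP=> x; rewrite !inE negb_and negb_or.
case/andP=> /and3P[_ -> /existsP[b /andP[]]]; rewrite inE => /andP[Bb Cb] ax.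
by case/andP=> /andP[-> ->] _; apply/andP; split; apply/existsP; exists b;
  rewrite ?Bb ?Cb.
Qed.

(** No nonempty set disjoint from [X] has fewer than [j] neighbours outside
[R]. *)
Definition linked {G : graph} (j : nat) (R X : {set G}) : Prop :=
  forall B : {set G}, B != set0 -> [disjoint B & X] -> j <= #|nbhd R B|.

Lemma j_connected_linked (G : graph) (j : nat) (X : {set G}) :
  j_connected j G -> j <= #|X| -> linked j set0 X.
Proof.
case=> _ conn leX B /set0Pn[b Bb] disBX; rewrite leqNgt; apply/negP => ltj.
have [x Xx Nx] : exists2 x, x \in X & x \notin nbhd set0 B.
  by apply/subsetPn; apply: contraL ltj => /subset_leq_card; lia.
have Bx : x \notin B by rewrite (disjointFl disBX).
have [_ /(_ b x)] := conn _ ltj.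
have -> : b \in svert (del_verts (nbhd set0 B)) by rewrite /= !inE Bb.
have -> : x \in svert (del_verts (nbhd set0 B)) by rewrite /= inE.
move=> /(_ isT isT)/connectP[p pth xp].
suff : last b p \in B by rewrite -xp (negPf Bx).
elim: p {xp} b Bb pth => //= y p IHp b Bb /andP[/and3P[_ Ny aby]].
apply: IHp; apply: contraLR Ny => By; rewrite inE negbK /nbhd !inE By.
by apply/existsP; exists b; rewrite Bb.
Qed.

(** * Fans *)

(** A [j]-spider from [v] to [X] avoiding [R], encoded as a rooted tree: [S] is
its vertex set, [v] its branch, [f] the parent function (meaningful on [S]
minus [v]) and [d] a rank that strictly decreases towards the root. The root
has [j] children, the other vertices outside [X] have exactly one child, and
the vertices in [X] have none, because parents are never in [X]. *)
Record fan (j : nat) {G : graph} (v : G) (X R S : {set G}) (f : G -> G)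
    (d : G -> nat) : Prop := Fan {
  fan_root : v \in S;
  fan_rootX : v \notin X;
  fan_avoid : [disjoint S & R];
  fan_parent : forall x, x \in S -> x != v ->
    [/\ f x \in S, f x \notin X, adj (f x) x & d (f x) < d x];
  fan_inj : forall x y, x \in S -> y \in S -> x != v -> y != v ->
    f x = f y -> f x != v -> x = y;
  fan_deg : #|[set x in S :\ v | f x == v]| = j;
  fan_child : forall x, x \in S -> x \notin X -> x != v ->
    exists2 y, y \in S :\ v & f y = x
}.

(** Each vertex of a fan outside [X] other than the root has one child, so a set
[C] that contains the root and is disjoint from [X] has [j + #|C| - 1]
children. *)
Lemma card_children (j : nat) {G : graph} (v : G) (X R S : {set G})
    (f : G -> G) (d : G -> nat) (C : {set G}) :
  fan j v X R S f d -> v \in C -> C \subset S -> [disjoint C & X] ->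
  #|[set x in S :\ v | f x \in C]| + 1 = j + #|C|.
Proof.
move=> [vS vX _ par inj deg child] vC CS CX.
rewrite (cardsD1 v C) vC addnCA addnC; congr (_ + _).
rewrite -deg -(cardsID [set x | f x == v]); congr (_ + _).
  apply: eq_card => x; rewrite !inE; case: (f x =P v) => [->|]; last by rewrite !andbF.
  by rewrite vC !andbT.
have fI : {in [set x in S :\ v | f x \in C] :\: [set x | f x == v] &, injective f}.
  move=> x y; rewrite !inE => /andP[fx /andP[/andP[xv xS] _]].
  by case/andP=> _ /andP[/andP[yv yS] _] fxy; apply: inj.
rewrite -(card_in_imset fI); apply: eq_card => z; apply/imsetP/idP.
  case=> x; rewrite !inE => /andP[fx /andP[_ fC]] ->; by rewrite fx.
case/setD1P=> zv zC; have zS := subsetP CS z zC.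
have [|y yS fy] := child z zS _ zv; first by rewrite (disjointFr CX).
by exists y => //; move: yS; rewrite !inE fy zv zC andbT.
Qed.

Lemma fan_card (j : nat) {G : graph} (v : G) (X R S : {set G})
    (f : G -> G) (d : G -> nat) :
  fan j v X R S f d -> #|S :&: X| = j.
Proof.
move=> F; have [vS vX _ par _ _ _] := F.
have := card_children (C := S :\: X) F.
rewrite inE vS vX subsetDl disjoints_subset => /(_ isT isT).
have -> : S :\: X \subset ~: X by apply/subsetP=> x; rewrite !inE => /andP[].
move=> /(_ isT).
have -> : [set x in S :\ v | f x \in S :\: X] = S :\ v.
  apply/setP=> x; rewrite !inE; case: eqP => //= /eqP xv.
  by have [xS|//] := boolP (x \in S); have [-> ->] := par x xS xv.
have := cardsID X S; have := cardsD1 v S; rewrite vS; lia.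
Qed.

(** The [j] legs of a fan leave a set around the root through different
neighbours of it; when there are only [j] of these, the fan covers all of
them. *)
Lemma fan_tight (j : nat) {G : graph} (v : G) (X R S B : {set G})
    (f : G -> G) (d : G -> nat) :
  fan j v X R S f d -> v \in B -> [disjoint B & X] -> #|nbhd R B| <= j ->
  nbhd R B \subset S.
Proof.
move=> F vB BX leN; have [vS vX SR par _ _ _] := F.
(* E is the set of vertices at which the fan leaves B. *)
set E := [set x in S :\ v | f x \in S :&: B] :\: B.
have EN : E \subset nbhd R B :&: S.
  apply/subsetP=> x; rewrite !inE => /andP[xB /andP[/andP[xv xS] /andP[_ fB]]].
  rewrite xB xS (disjointFr SR) //= andbT; apply/existsP; exists (f x).
  by have [_ _ ->] := par x xS xv; rewrite fB.
have leE : j <= #|E|.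
  have := card_children (C := S :&: B) F.
  rewrite inE vS vB subsetIl => /(_ isT isT).
  rewrite (disjointWl (subsetIr S B)) // => /(_ isT).
  have := cardsID B [set x in S :\ v | f x \in S :&: B]; rewrite -/E.
  have : #|[set x in S :\ v | f x \in S :&: B] :&: B| <= #|(S :&: B) :\ v|.
    apply: subset_leq_card; apply/subsetP=> x; rewrite !inE.
    by case/andP=> /andP[/andP[-> ->] _] ->.
  have := cardsD1 v (S :&: B); rewrite inE vS vB; lia.
have /eqP <- : nbhd R B :&: S == nbhd R B.
  rewrite eqEcard subsetIl; apply: leq_trans leN (leq_trans leE _).
  exact: subset_leq_card.
exact: subsetIr.
Qed.

(** The choice of the branch: any fan from the vertex [v] provided here
preserves the invariant when [v] joins the set of forbidden vertices. *)
Lemma tight_root (G : graph) (j : nat) (X R : {set G}) :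
  X != setT -> R \subset X -> linked j R X ->
  exists2 v, v \notin X & forall (S : {set G}) (f : G -> G) (d : G -> nat),
    fan j v X R S f d -> linked j (v |: R) (X :|: S).
Proof.
move=> XT RX link.
pose tight (B : {set G}) := [&& B != set0, [disjoint B & X] & #|nbhd R B| == j].
have reduce v (B : {set G}) : #|nbhd R B| <= #|nbhd (v |: R) B| + (v \in nbhd R B).
  rewrite (cardsD1 v (nbhd R B)) addnC leq_add2r; apply: subset_leq_card.
  by apply/subsetP=> x; rewrite !inE negb_or => /and4P[-> -> -> ->].
have [/existsP[B0 tB0]|notight] := boolP [exists B, tight B]; last first.
  have /subsetPn[v _ vX] : ~~ ([set: G] \subset X) by rewrite subTset.
  exists v => // S f d _ B B0 disB; have disBX := disjointWr (subsetUl X S) disB.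
  have := reduce v B; have := link B B0 disBX; move/existsPn: notight => /(_ B).
  by rewrite /tight B0 disBX /=; case: (v \in _); lia.
have [B /minsetP[/and3P[/set0Pn[v vB] BX /eqP NB] minB] _] := minset_exists tB0.
exists v => [|S f d F]; first by rewrite (disjointFr BX).
have vS := fan_root F.
have NS : nbhd R B \subset S by apply: fan_tight F vB BX _; rewrite NB.
move=> C C0 disC; have disCX := disjointWr (subsetUl X S) disC.
have CS x : x \in S -> x \notin C.
  by move=> xS; rewrite (disjointFl disC) // inE xS orbT.
rewrite leqNgt; apply/negP => ltC.
have := reduce v C; have leC := link C C0 disCX.
have [vN ltCj|_] := boolP (v \in nbhd R C); last first.
  by rewrite addn0 => /(leq_trans leC); rewrite leqNgt ltC.
(* C is now tight and has v as a neighbour. *)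
have [w wC vw] : exists2 w, w \in C & adj v w.
  move: vN; rewrite inE => /and3P[_ _ /existsP[w /andP[wC aw]]].
  by exists w; rewrite // adj_sym.
have [wB|wB] := boolP (w \in B); last first.
  suff /CS : w \in S by rewrite wC.
  apply: (subsetP NS); rewrite inE wB /=; apply/andP; split.
    by apply: contraTN wC => /(subsetP RX) wX; rewrite (disjointFl disCX).
  by apply/existsP; exists v; rewrite vB.
have BC0 : B :&: C != set0 by apply/set0Pn; exists w; rewrite inE wB.
have leI : j <= #|nbhd R (B :&: C)|.
  by apply: link; rewrite // (disjointWl (subsetIl _ _)).
have leU : j <= #|nbhd R (B :|: C)|.
  apply: link; first by apply/set0Pn; exists w; rewrite inE wB.
  by rewrite -setI_eq0 setIUl setU_eq0 !setI_eq0 BX.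
have sub := nbhd_submod R B C.
have : B :&: C = B.
  apply: minB (subsetIl _ _); rewrite /tight BC0 (disjointWl (subsetIl _ _)) //=.
  by move: sub ltCj ltC leI leU; rewrite NB; clear; lia.
by move/setP/(_ v); rewrite inE vB (negPf (CS v vS)).
Qed.

(** * Existence of fans *)

(** The successor functions behind a fan: [a k] is the first vertex of the
[k]-th leg, and [g x] is the vertex after [x], possibly [x] itself when [x] is
on no leg. Hall's condition for a family consisting of [i] copies of [v]
and a set [C] of other vertices holds because [C], together with the at least
[j] neighbours of [v |: C], is available. *)
Lemma fan_matching (G : graph) (j : nat) (R X : {set G}) (v : G) :
    R \subset X -> v \notin X -> linked j R X ->
  exists (a : 'I_j -> G) (g : G -> G),
    [/\ injective a, {in ~: X :\ v &, injective g},
        forall k x, x \in ~: X :\ v -> a k != g x,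
        forall k, adj v (a k) /\ a k \notin R
      & forall x, x \in ~: X :\ v ->
          [/\ g x != v, g x \notin R & (g x == x) || adj x (g x)]].
Proof.
move=> RX vX link.
pose D : {set 'I_j + G} :=
  [set i | if i is inr x then x \in ~: X :\ v else true].
pose A (i : 'I_j + G) : {set G} := match i with
  | inl _ => [set y | adj v y && (y \notin R)]
  | inr x => [set y | [&& y != v, y \notin R & (y == x) || adj x y]]
  end.
have [J JD|f [fA f_inj]] := hall v (D := D) (A := A).
  pose C := [set x | inr x \in J].
  have CX : C \subset ~: X :\ v.
    by apply/subsetP=> x; rewrite inE => /(subsetP JD); rewrite inE.
  have CU : C \subset \bigcup_(i in J) A i.
    apply/subsetP=> x Cx; apply/bigcupP; exists (inr x); first by rewrite inE in Cx.
    have := subsetP CX x Cx; rewrite !inE => /andP[-> xX]; rewrite eqxx andbT /=.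
    by apply: contra xX => /(subsetP RX).
  have [/existsP[k kJ]|noinl] := boolP [exists k, inl k \in J]; last first.
    apply: leq_trans (subset_leq_card CU); rewrite -(card_imset C (@inr_inj 'I_j G)).
    apply: subset_leq_card; apply/subsetP=> [[k kJ|x xJ]].
      by move/existsPn: noinl => /(_ k); rewrite kJ.
    by apply/imsetP; exists x; rewrite ?inE.
  have vC : v \notin C by apply/negP=> /(subsetP CX); rewrite !inE eqxx.
  have leJ : #|J| <= j + #|C|.
    rewrite -(card_imset C (@inr_inj 'I_j G)) -[X in X + _]card_ord.
    rewrite -(cardsT 'I_j) -(card_imset setT (@inl_inj 'I_j G)).
    apply: leq_trans (leq_card_setU _ _); apply: subset_leq_card.
    apply/subsetP=> [[l lJ|x xJ]]; rewrite inE; apply/orP; [left|right].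
      exact: imset_f.
    by apply: imset_f; rewrite inE.
  have link_vC : j <= #|nbhd R (v |: C)|.
    apply: link; first by apply/set0Pn; exists v; rewrite !inE eqxx.
    rewrite disjoints_subset; apply/subsetP=> x /setU1P[->|/(subsetP CX)].
      by rewrite inE.
    by rewrite !inE => /andP[].
  have disC : [disjoint C & nbhd R (v |: C)].
    rewrite disjoints_subset; apply/subsetP=> x Cx.
    by rewrite !inE; move: Cx; rewrite inE => ->; rewrite orbT.
  apply: leq_trans leJ _; apply: leq_trans (_ : #|C :|: nbhd R (v |: C)| <= _).
    by rewrite cardsU disjoint_setI0 // cards0 subn0 addnC leq_add2l.
  apply: subset_leq_card; rewrite subUset CU; apply/subsetP=> x.
  rewrite !inE negb_or => /and3P[/andP[xv xC] xR /existsP[b /andP[]]].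
  rewrite !inE => /orP[/eqP->|bJ] bx; apply/bigcupP.
    by exists (inl k); rewrite // inE bx.
  by exists (inr b); rewrite // inE xv xR bx orbT.
have fl k : f (inl k) \in [set y | adj v y && (y \notin R)].
  by apply: (fA (inl k)); rewrite inE.
have fr x : x \in ~: X :\ v ->
  f (inr x) \in [set y | [&& y != v, y \notin R & (y == x) || adj x y]].
  by move=> xW; apply: (fA (inr x)); rewrite inE.
exists (fun k => f (inl k)), (fun x => f (inr x)); split.
- by move=> k l /f_inj; rewrite !inE => /(_ isT isT)[].
- by move=> x y xW yW /f_inj; rewrite [inr x \in D]inE [inr y \in D]inE => /(_ xW yW)[].
- move=> k x xW; apply/eqP=> /f_inj.
  by rewrite [inl k \in D]inE [inr x \in D]inE => /(_ isT xW).
- by move=> k; have := fl k; rewrite inE => /andP[].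
- by move=> x /fr; rewrite inE => /and3P[].
Qed.

Lemma fan_exists (G : graph) (j : nat) (R X : {set G}) (v : G) :
    R \subset X -> v \notin X -> linked j R X ->
  exists S f d, fan j v X R S f d.
Proof.
move=> RX vX link.
have [a [g [a_inj g_inj ag aP gP]]] := fan_matching RX vX link.
set W := ~: X :\ v in g_inj ag gP.
(* [orb k n] is the n-th vertex of the k-th leg; it is meaningful as long as
   the leg has not met X before, which is what [valid k n] says. *)
pose orb k n := iter n g (a k).
pose valid k n := [forall m : 'I_n, orb k m \notin X].
have validP k n : reflect (forall m, m < n -> orb k m \notin X) (valid k n).
  apply: (iffP forallP) => [H m ltm|H m]; first exact: (H (Ordinal ltm)).
  exact: H.
have validS k n : valid k n.+1 -> valid k n.
  by move/validP=> H; apply/validP=> m ltm; apply: H; apply: leq_trans ltm _.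
have orb_good k n : valid k n -> orb k n != v /\ orb k n \notin R.
  elim: n => [_|n IHn vn] /=.
    by have [av ->] := aP k; split=> //; apply: contraTneq av => ->; rewrite adj_irrefl.
  have [nv _] := IHn (validS _ _ vn).
  have [|-> -> _] := gP (orb k n); last by split.
  by rewrite !inE nv; move/validP: vn; apply.
have orbW k n : valid k n.+1 -> orb k n \in W.
  move=> vn; have [nv _] := orb_good k n (validS _ _ vn).
  by rewrite !inE nv; move/validP: vn; apply.
(* Injectivity of the successor functions makes the legs disjoint and free of
   repetitions, so parents and ranks are well defined. *)
have orb_inj k n l m : valid k n -> valid l m -> orb k n = orb l m -> k = l /\ n = m.
  elim: n m => [|n IHn] [|m] vn vm /=.
  - by move/a_inj->.
  - by move/eqP; rewrite (negPf (ag _ _ (orbW _ _ vm))).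
  - by move/eqP; rewrite eq_sym (negPf (ag _ _ (orbW _ _ vn))).
  move/g_inj; rewrite !orbW // => /(_ isT isT) /IHn.
  by case/(_ (validS _ _ vn) (validS _ _ vm)) => -> ->.
have valid_le k n : valid k n -> n <= #|G|.
  move=> vn; rewrite -[n]card_ord.
  apply: (leq_card (fun m : 'I_n => orb k m)) => m1 m2 /orb_inj[].
  - by apply/validP=> m ltm; move/validP: vn; apply; apply: ltn_trans ltm _.
  - by apply/validP=> m ltm; move/validP: vn; apply; apply: ltn_trans ltm _.
  - by move=> _ /val_inj.
(* A leg has at most #|G| steps, so its positions range over a finite type. *)
pose good y := [pred p : 'I_j * 'I_(#|G|.+1) | valid p.1 p.2 && (orb p.1 p.2 == y)].
pose S : {set G} := v |: [set y | [exists p, good y p]].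
pose f y := if [pick p | good y p] is Some p then
    if p.2 is Ordinal n.+1 _ then orb p.1 n else v else v.
pose d y := if [pick p | good y p] is Some p then (val p.2).+1 else 0.
have goodE k n : valid k n -> [/\ orb k n \in S,
    f (orb k n) = if n is m.+1 then orb k m else v & d (orb k n) = n.+1].
  move=> vn; have ltn : n < #|G|.+1 by rewrite ltnS; apply: valid_le vn.
  have gp : good (orb k n) (k, Ordinal ltn) by rewrite /= vn eqxx.
  split; first by rewrite !inE; apply/orP; right; apply/existsP; exists (k, Ordinal ltn).
    rewrite /f; case: pickP => [[l [m ltm]] /=|/(_ (k, Ordinal ltn))]; last by rewrite gp.
    by case/andP=> vm /eqP /orb_inj[] // -> ->.
  rewrite /d; case: pickP => [[l [m ltm]] /=|/(_ (k, Ordinal ltn))]; last by rewrite gp.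
  by case/andP=> vm /eqP /orb_inj[] // _ ->.
have SP x : x \in S -> x != v -> exists k n, valid k n /\ x = orb k n.
  rewrite !inE => /orP[/eqP->|/existsP[[k [n ltn]] /andP[/= vn /eqP <-]] _].
    by rewrite eqxx.
  by exists k, n.
have dv : d v = 0.
  rewrite /d; case: pickP => // -[k n] /andP[/= vn /eqP nv].
  by have [] := orb_good k n vn; rewrite nv eqxx.
exists S, f, d; split=> //.
- by rewrite !inE eqxx.
- rewrite disjoints_subset; apply/subsetP=> x xS; rewrite inE.
  have [->|xv] := eqVneq x v; first by apply: contra vX => /(subsetP RX).
  by have [k [n [vn ->]]] := SP x xS xv; have [] := orb_good k n vn.
- move=> x xS xv; have [k [[|n] [vn xE]]] := SP x xS xv; rewrite xE.
    have [_ -> ->] := goodE k 0 vn; rewrite dv; have [av _] := aP k.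
    by rewrite vX av; split; rewrite // !inE eqxx.
  have vn' := validS _ _ vn; have [_ -> ->] := goodE k n.+1 vn.
  have [-> _ ->] := goodE k n vn'; split=> //; first by move/validP: vn; apply.
  have [_ _ /orP[/eqP ee|//]] := gP _ (orbW k n vn).
  have /orb_inj[//||] : orb k n.+1 = orb k n by exact: ee.
    exact: vn'.
  by move=> _ /eqP; rewrite eqn_leq ltnn.
- move=> x y xS yS xv yv.
  have [k [n [vn ->]]] := SP x xS xv; have [l [m [vm ->]]] := SP y yS yv.
  have [_ -> _] := goodE k n vn; have [_ -> _] := goodE l m vm.
  case: n m vn vm => [|n] [|m] vn vm //; rewrite ?eqxx //.
    by move=> <-; rewrite eqxx.
  by case/(orb_inj _ _ _ _ (validS _ _ vn) (validS _ _ vm)) => -> ->.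
- rewrite -[RHS]card_ord -(card_imset 'I_j a_inj).
  have v0 k : valid k 0 by apply/validP.
  apply: eq_card => x; apply/idP/imsetP.
    rewrite inE => /andP[/setD1P[xv xS] /eqP fx].
    have [k [n [vn xE]]] := SP x xS xv; exists k => //; move: fx; rewrite xE.
    have [_ -> _] := goodE k n vn; case: n vn {xE} => // n vn nv.
    by have [] := orb_good k n (validS _ _ vn); rewrite nv eqxx.
  case=> k _ ->; have [kS fk _] := goodE k 0 (v0 k).
  have [kv _] := orb_good k 0 (v0 k).
  by apply/setIdP; split; [apply/setD1P | apply/eqP].
- move=> x xS xX xv; have [k [n [vn xE]]] := SP x xS xv.
  have vn1 : valid k n.+1.
    apply/validP=> m; rewrite ltnS leq_eqVlt => /orP[/eqP->|]; first by rewrite -xE.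
    by move: m; apply/validP.
  have [nS fn _] := goodE k n.+1 vn1; exists (orb k n.+1); last by rewrite fn.
  by have [nv _] := orb_good k n.+1 vn1; apply/setD1P.
Qed.

(** * Fans as spiders *)

(** A new vertex [u] adjacent to both ends of an edge of a fan can be inserted
into this edge. *)
Lemma fan_insert (j : nat) (G : graph) (v : G) (X R S : {set G}) (f : G -> G)
    (d : G -> nat) (x u : G) :
    fan j v X R S f d -> R \subset X -> x \in S -> x != v -> u \notin X :|: S ->
    adj u x -> adj (f x) u ->
  exists f' d', fan j v X R (u |: S) f' d'.
Proof.
move=> F RX xS xv; rewrite inE negb_or => /andP[uX uS] ux xu.
have [vS vX SR par inj deg child] := F.
have neqS z : z \in S -> z != u by move=> zS; apply: contraNneq uS => <-.
have [fS fX fa fd] := par x xS xv.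
have uv : u != v by rewrite eq_sym neqS.
(* Doubling the ranks makes room for u between x and f x. *)
pose f' z := if z == u then f x else if z == x then u else f z.
pose d' z := if z == u then (2 * d (f x)).+1 else 2 * d z.
have f'u : f' u = f x by rewrite /f' eqxx.
have f'x : f' x = u by rewrite /f' (negPf (neqS x xS)) eqxx.
have f'z z : z \in S -> z != x -> f' z = f z.
  by move=> zS zx; rewrite /f' (negPf (neqS z zS)) (negPf zx).
have d'z z : z \in S -> d' z = 2 * d z by move=> zS; rewrite /d' (negPf (neqS z zS)).
exists f', d'; split.
- by rewrite inE vS orbT.
- exact: vX.
- rewrite disjoints_subset subUset sub1set -disjoints_subset SR andbT inE.
  by apply: contra uX => /(subsetP RX).
- move=> z /setU1P[->|zS] zv.
    by rewrite f'u inE fS orbT d'z // /d' eqxx ltnSn.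
  rewrite (d'z z) //; have [->|zx] := eqVneq z x.
    by rewrite f'x /d' eqxx; split=> //; [rewrite !inE eqxx | move: fd; clear; lia].
  have [fzS fzX fza fzd] := par z zS zv.
  by rewrite f'z // d'z // inE fzS orbT; split=> //; move: fzd; clear; lia.
- move=> y z yS' zS' yv zv.
  have aux w : w \in S -> w != v -> w != x -> f x = f w -> f x != v -> False.
    by move=> wS wv wx fw fv; case/eqP: wx; apply/esym/inj.
  case/setU1P: yS' => [->|yS]; case/setU1P: zS' => [->|zS] //.
  + rewrite f'u; have [->|zx] := eqVneq z x; first by rewrite f'x => fu; rewrite fu (negPf uS) in fS.
    by rewrite f'z // => /aux h /h [].
  + rewrite f'u; have [->|yx] := eqVneq y x; first by rewrite f'x => fu; rewrite -fu (negPf uS) in fS.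
    by rewrite f'z // => e; rewrite e => /(aux _ yS yv yx (esym e)).
  have [-> //|yx] := eqVneq y x; have [zx|zx] := eqVneq z x => //.
  + by rewrite ?zx f'x f'z // => fu; have [] := par z zS zv; rewrite -fu (negPf uS).
  + by rewrite zx f'x f'z // => fu; have [] := par y yS yv; rewrite fu (negPf uS).
  by rewrite !f'z //; apply: inj.
- rewrite -deg; have [fxv|fxv] := eqVneq (f x) v.
    set A := [set z in S :\ v | f z == v].
    have -> : [set z in (u |: S) :\ v | f' z == v] = u |: A :\ x.
      apply/setP=> z; rewrite !inE; have [->|zu] := eqVneq z u; first by rewrite f'u fxv uv eqxx.
      have [->|zx] := eqVneq z x; first by rewrite f'x (negPf uv) andbF.
      by have [zS|/=] := boolP (z \in S); rewrite ?andbF //= f'z.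
    rewrite cardsU1 !inE (negPf uS) !andbF /= (cardsD1 x A) !inE xv xS fxv eqxx.
    by [].
  apply: eq_card => z; rewrite !inE; have [->|zu] := eqVneq z u.
    by rewrite f'u (negPf fxv) !andbF (negPf uS) !andbF.
  have [->|zx] := eqVneq z x; first by rewrite f'x (negPf uv) (negPf fxv) !andbF.
  by have [zS|/=] := boolP (z \in S); rewrite ?andbF //= f'z.
- move=> z /setU1P[-> _ _|zS zX zv].
    by exists x => //; rewrite !inE xv xS orbT.
  have [y /setD1P[yv yS] fy] := child z zS zX zv.
  have [yx|yx] := eqVneq y x.
    by exists u; rewrite ?f'u -?yx // !inE uv eqxx.
  by exists y; rewrite ?f'z // !inE yv yS orbT.
Qed.

Section FanGraph.
Variables (j : nat) (G : graph) (v : G) (X R S : {set G}) (f : G -> G).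
Variable d : G -> nat.

Definition fan_edge : rel G := fun x y =>
  [&& x \in S, y \in S, adj x y & (x != v) && (f x == y) || (y != v) && (f y == x)].

Lemma fan_edge_sym : symmetric fan_edge.
Proof. by move=> x y; rewrite /fan_edge andbCA adj_sym orbC. Qed.

Lemma fan_edge_sub x y : fan_edge x y -> [&& x \in S, y \in S & adj x y].
Proof. by case/and4P=> -> -> ->. Qed.

(** The subgraph formed by the edges between a vertex and its parent. *)
Definition fan_graph : subgraph G := Subgraph fan_edge_sym fan_edge_sub.

Hypothesis F : fan j v X R S f d.

Lemma fan_edgeP x y : fan_edge x y ->
  [/\ x \in S, x != v, f x = y & d y < d x] \/
  [/\ y \in S, y != v, f y = x & d x < d y].
Proof.
case/and4P=> xS yS _ /orP[] /andP[nv /eqP fE]; [left|right].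
  by have [_ _ _ lt] := fan_parent F xS nv; rewrite -fE.
by have [_ _ _ lt] := fan_parent F yS nv; rewrite -fE.
Qed.

Lemma fan_edge_parent x : x \in S -> x != v -> fan_edge x (f x).
Proof.
move=> xS xv; have [fS _ fa _] := fan_parent F xS xv.
by rewrite /fan_edge xS fS adj_sym fa xv eqxx.
Qed.

Let child x : {set G} := [set y in S :\ v | f y == x].

Lemma fan_nbrs x : x \in S ->
  [set y | fan_edge x y] = if x == v then child x else f x |: child x.
Proof.
move=> xS; apply/setP=> y.
have -> : (y \in [set y | fan_edge x y]) = (y \in child x) || (x != v) && (y == f x).
  rewrite inE; apply/idP/orP => [/fan_edgeP[[_ xv fx _]|[yS yv fy _]]|].
  - by right; rewrite xv fx eqxx.
  - by left; rewrite !inE yv yS fy eqxx.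
  case=> [|/andP[xv /eqP->]]; last exact: fan_edge_parent.
  by rewrite !inE => /andP[/andP[yv yS] /eqP <-]; rewrite fan_edge_sym fan_edge_parent.
by case: eqP => _; rewrite /= ?orbF // [RHS]inE orbC inE.
Qed.

Lemma fan_degree x :
  degree fan_graph x = if x \notin S then 0 else if x == v then j
                       else if x \in X then 1 else 2.
Proof.
have [vS vX SR par inj deg chi] := F.
rewrite /degree /=; have [xS|xS] /= := boolP (x \in S); last first.
  by apply: eq_card0 => y; rewrite inE /fan_edge (negPf xS).
rewrite fan_nbrs //; case: eqP => [->//|/eqP xv].
have [_ _ _ fd] := par x xS xv.
rewrite cardsU1; have -> : f x \notin child x.
  rewrite !inE; apply/negP=> /andP[/andP[fv fS] /eqP ffx].
  by have [_ _ _] := par (f x) fS fv; rewrite ffx ltnNge ltnW.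
have [xX|xX] := boolP (x \in X).
  suff -> : child x = set0 by rewrite cards0.
  apply/setP=> y; rewrite !inE; apply/negP=> /andP[/andP[yv yS] /eqP fy].
  by have [_] := par y yS yv; rewrite fy xX.
have [y /setD1P[yv yS] fy] := chi x xS xX xv.
suff -> : child x = [set y] by rewrite cards1.
apply/setP=> z; rewrite !inE; apply/idP/eqP => [/andP[/andP[zv zS] /eqP fz]|->].
  by apply: inj; rewrite ?fy ?fz.
by rewrite yv yS fy eqxx.
Qed.

Lemma fan_connected : sconnected fan_graph.
Proof.
have [vS vX SR par inj deg chi] := F.
split=> [|x y xS yS]; first by apply/set0Pn; exists v.
have root z : z \in S -> connect fan_edge z v.
  have [n] := ubnP (d z); elim: n z => // n IHn z ltn zS.
  have [->//|zv] := eqVneq z v.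
  have [fS _ _ fd] := par z zS zv; apply: connect_trans (connect1 _) (IHn _ _ fS).
    exact: fan_edge_parent.
  exact: leq_trans fd ltn.
apply: connect_trans (root x xS) _.
by rewrite (sym_connect_sym fan_edge_sym) root.
Qed.

(** A vertex of largest rank on a cycle would have its parent as both
neighbours. *)
Lemma fan_acyclic : acyclic fan_graph.
Proof.
move=> c /andP[cyc uc]; rewrite leqNgt; apply/negP => szc.
have [x0 x0c] : exists x, x \in c by case: c szc {cyc uc} => // x; exists x; rewrite inE eqxx.
case: (arg_maxnP d x0c) => x xc dmax.
have [i p cE] := rot_to xc.
have up y : y \in c -> fan_edge x y -> f x = y.
  move=> yc /fan_edgeP[[_ _ ->]//|[_ _ _]].
  by have /= le_yx := dmax y yc; rewrite ltnNge le_yx.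
have memp y : y \in p -> y \in c by move=> yp; rewrite -(mem_rot i) cE inE yp orbT.
move: cyc uc szc; rewrite -(rot_cycle i) -(rot_uniq i) -(size_rot i) cE.
case: p memp {cE} => // y; case/lastP=> // p z memp.
rewrite /= rcons_path rcons_uniq last_rcons => /and3P[xy _ zx].
have yc : y \in c by apply: memp; rewrite inE eqxx.
have zc : z \in c by apply: memp; rewrite !inE mem_rcons inE eqxx orbT.
have fxz : f x = z by apply: up zc _; rewrite fan_edge_sym.
have -> : y = z by rewrite -fxz; apply/esym/up.
by rewrite mem_rcons inE eqxx /= andbF.
Qed.

Hypothesis j_ge2 : 2 <= j.

Lemma fan_feet : feet fan_graph = S :&: X.
Proof.
have [vS vX _ _ _ _ _] := F.
apply/setP=> x; rewrite !inE fan_degree; case: (boolP (x \in S)) => //= _.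
case: (x =P v) => [->|_]; last by case: (x \in X).
by rewrite (negPf vX) eqn_leq leqNgt j_ge2.
Qed.

Lemma fan_branch x : is_branch fan_graph x -> 3 <= j -> x = v.
Proof.
rewrite /is_branch => + j_ge3; have [vS _ _ _ _ _ _] := F.
case: existsP => [_|[]]; last by exists v; rewrite fan_degree vS eqxx.
by rewrite fan_degree; case: (x \in S) => //=; case: eqP => // _; case: ifP.
Qed.

Lemma fan_spider : j <= #|X| -> spider_from fan_graph j v X.
Proof.
move=> leX; have [vS vX SR par inj deg chi] := F.
have degv : degree fan_graph v = j by rewrite fan_degree vS eqxx.
have brv : is_branch fan_graph v.
  rewrite /is_branch degv; case: existsP => [[u]|noex].
    rewrite fan_degree; case: (u \in S) => //=; case: eqP => // _; by case: ifP.
  rewrite eqn_leq j_ge2 andbT leqNgt; apply/negP => j3.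
  by apply: noex; exists v; rewrite degv.
split; last by rewrite fan_feet subsetIr.
split=> //; split; last by exists v.
  split; first by split; [apply: fan_connected | apply: fan_acyclic].
  apply: (@leq_trans #|[set v]|); last by rewrite cards1.
  apply: subset_leq_card; apply/subsetP=> u.
  rewrite !inE fan_degree; case: (u \in S) => //=; case: eqP => // _; by case: ifP.
by rewrite fan_feet (fan_card F).
Qed.

End FanGraph.

(** * Maximal spiders *)

(** No vertex outside [Y] is adjacent to both ends of an edge of [H]. *)
Definition unsplittable {G : graph} (H : subgraph G) (Y : {set G}) : Prop :=
  forall x y u, sedge H x y -> u \notin Y -> adj x u -> ~~ adj u y.

Definition no_isolated {G : graph} (H : subgraph G) : Prop :=
  forall x, x \in svert H -> exists y, sedge H x y.

(** One step of the construction: a largest fan from the root given by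
[tight_root]. The last property says that the neighbour of a foot is a new
vertex. *)
Lemma spider_step (G : graph) (j : nat) (X R : {set G}) :
    2 <= j -> X != setT -> R \subset X -> j <= #|X| -> linked j R X ->
  exists (v : G) (H : subgraph G),
    [/\ spider_from H j v X, linked j (v |: R) (X :|: svert H),
        [disjoint feet H & R] & 3 <= j -> forall u, is_branch H u -> u = v] /\
    [/\ unsplittable H (X :|: svert H), no_isolated H
      & forall x y, sedge H x y -> x \in feet H -> y \notin X].
Proof.
move=> j2 XT RX leX link; have [v vX vlink] := tight_root XT RX link.
have [S0 fanS0] := fan_exists RX vX link.
have [S [f [d F]] Smax] := ex_max_card (P := fun S => exists f d, fan j v X R S f d) fanS0.
have [vS _ SR par inj deg chi] := F.
exists v, (fan_graph v S f); split; split.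
- exact: fan_spider F j2 leX.
- exact: vlink F.
- by rewrite (fan_feet F) // (disjointWl (subsetIl _ _)).
- by move=> j3 u bu; exact: (fan_branch F bu j3).
- move=> x y u exy; rewrite /= => uY xu; apply/negP=> uy.
  have uS : u \notin S by apply: contra uY => uS; rewrite inE uS orbT.
  have max f' d' : ~ fan j v X R (u |: S) f' d'.
    move=> F'; have := Smax (u |: S) (ex_intro _ f' (ex_intro _ d' F')).
    by rewrite cardsU1 uS ltnn.
  case: (fan_edgeP F exy) => [] [zS zv fz _]; subst.
    have [||f' [d' /max]] // := fan_insert F RX zS zv uY.
      by rewrite adj_sym.
    by rewrite adj_sym.
  by have [||f' [d' /max]] // := fan_insert F RX zS zv uY.
- move=> x /= xS; have [->|xv] := eqVneq x v; last first.
    by exists (f x); exact: (fan_edge_parent F xS xv).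
  have : 0 < #|[set x in S :\ v | f x == v]| by rewrite deg ltnW.
  case/card_gt0P=> y; rewrite !inE => /andP[/andP[yv yS] /eqP fy].
  by exists y; have := fan_edge_parent F yS yv; rewrite fy fan_edge_sym.
move=> x y exy; rewrite (fan_feet F) // inE => /andP[xS xX].
case: (fan_edgeP F exy) => [] [zS zv fz _].
  by have [_] := par x zS zv; rewrite fz.
by have [_] := par y zS zv; rewrite fz xX.
Qed.

(** * Longest cycles *)

(** Adjacency along the cyclic sequence [c]. *)
Definition cycle_edge {T : eqType} (c : seq T) : rel T := fun x y =>
  (x \in c) && (y == next c x) || (y \in c) && (x == next c y).

Lemma cycle_edge_sym (T : eqType) (c : seq T) : symmetric (cycle_edge c).
Proof. by move=> x y; rewrite /cycle_edge orbC. Qed.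

Section CycleGraph.
Variables (G : graph) (c : seq G).
Hypothesis (cyc : cycle (@adj G) c) (uc : uniq c) (szc : 2 < size c).

Lemma cycle_edge_sub x y :
  cycle_edge c x y -> [&& x \in [set z in c], y \in [set z in c] & adj x y].
Proof.
rewrite !inE; case/orP=> /andP[zc /eqP->]; rewrite mem_next zc /=.
  exact: next_cycle cyc zc.
by rewrite adj_sym; apply: next_cycle cyc zc.
Qed.

Definition cycle_graph : subgraph G := Subgraph (@cycle_edge_sym _ c) cycle_edge_sub.

Lemma cycle_graph_feet : feet cycle_graph = set0.
Proof.
apply/setP=> x; rewrite !inE; apply/negP=> /cards1P[y Ey].
have exy : cycle_edge c x y by have := set11 y; rewrite -Ey inE.
have xc : x \in c by have /and3P[] := cycle_edge_sub exy; rewrite inE.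
have nx : next c x = y.
  have : next c x \in [set u | sedge cycle_graph x u] by rewrite inE /= /cycle_edge xc eqxx.
  by rewrite Ey inE => /eqP.
have px : prev c x = y.
  have : prev c x \in [set u | sedge cycle_graph x u].
    by rewrite inE /= /cycle_edge mem_prev xc next_prev // eqxx orbT.
  by rewrite Ey inE => /eqP.
(* Going around c from x returns after two steps, but c is longer than that. *)
have nnx : next c (next c x) = x by rewrite nx -px next_prev.
move: uc szc nnx; have [i p cE] := rot_to xc.
rewrite -(rot_uniq i) -(size_rot i) -!(next_rot i uc) cE.
case: p {cE} => [|a [|b p]] //= /and3P[]; rewrite !inE !negb_or.
case/and3P=> xa xb xp /andP[ab ap] _ _.
rewrite !eqxx /= eq_sym (negPf xa) => bx.
by rewrite bx eqxx in xb.
Qed.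

Lemma cycle_graph_is_cycle : is_cycle cycle_graph.
Proof. by exists c. Qed.

Lemma cycle_insert x u : x \in c -> u \notin c -> adj x u -> adj u (next c x) ->
  exists c', [/\ cycle (@adj G) c', uniq c', 2 < size c' & c' =i u :: c].
Proof.
move=> xc uc' xu; have [i p cE] := rot_to xc.
move: cyc uc szc; rewrite -(rot_cycle i) -(next_rot i uc) -(rot_uniq i) -(size_rot i) cE.
move=> cp up sp ux; exists (x :: u :: p); split.
- case: p cE cp up sp ux => [|a p] //= cE /andP[xa ->] _ _.
  by rewrite eqxx => ->; rewrite xu.
- move: up; rewrite /= !inE !negb_or => /andP[-> ->].
  have : u \notin rot i c by rewrite mem_rot.
  by rewrite cE inE negb_or eq_sym => /andP[-> ->].
- exact: leq_trans sp _.
by move=> z; rewrite [RHS]inE -(mem_rot i c) cE !inE orbCA.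
Qed.

End CycleGraph.

Lemma split_last (T : Type) (a : pred T) (s : seq T) : has a s ->
  exists s1 x s2, [/\ s = rcons s1 x ++ s2, a x & ~~ has a s2].
Proof.
elim/last_ind: s => // s y IHs; rewrite has_rcons.
have [ay _|nay /= /IHs[s1 [x [s2 [-> ax ns2]]]]] := boolP (a y).
  by exists s, y, [::]; rewrite cats0.
by exists s1, x, (rcons s2 y); rewrite rcons_cat has_rcons negb_or nay.
Qed.

(** The first vertex of a longest path has all its neighbours on the path; the
edge to the last of them closes a cycle through all of them. *)
Lemma min_degree_cycle (G : graph) (j : nat) (x0 : G) :
    2 <= j -> (forall x : G, j <= #|[set y | adj x y]|) ->
  exists c, [/\ cycle (@adj G) c, uniq c, 2 < size c & j <= size c].
Proof.
move=> j2 mindeg.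
pose P (A : {set G}) := exists x p, [/\ path (@adj G) x p, uniq (x :: p) & A = [set y in x :: p]].
have [|A [x [p [pth up ->]]] Amax] := ex_max_card (P := P) (A0 := [set y in [:: x0]]).
  by exists x0, [::].
have nbp y : adj x y -> y \in p.
  move=> xy; apply/negPn/negP=> yp.
  have xney : y != x by apply: contraTneq xy => ->; rewrite adj_irrefl.
  have := Amax [set z in y :: x :: p]; rewrite !cardsE !(card_uniqP _) //; last first.
    by rewrite cons_uniq up inE negb_or xney yp.
  rewrite /= ltnn => H; suff: false by []; apply: H.
  exists y, (x :: p); split=> //; first by rewrite /= adj_sym xy.
  by rewrite cons_uniq up inE negb_or xney yp.
have [y xy] : exists y, adj x y.
  have : 0 < #|[set y | adj x y]| by apply: leq_trans (mindeg x); apply: ltnW.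
  by case/card_gt0P=> y; rewrite inE; exists y.
have hasp : has (adj x) p by apply/hasP; exists y => //; apply: nbp.
have [p1 [z [p2 [pE xz np2]]]] := split_last hasp.
have leq_p1 : j <= size (rcons p1 z).
  apply: leq_trans (mindeg x) _.
  apply: leq_trans (card_size (rcons p1 z)); apply: subset_leq_card.
  apply/subsetP=> w; rewrite inE => xw; have := nbp w xw.
  by rewrite pE mem_cat => /orP[//|wp2]; case/hasP: np2; exists w.
exists (x :: rcons p1 z); split.
- move: pth; rewrite pE cat_path => /andP[pth _].
  by rewrite /= rcons_path pth last_rcons adj_sym.
- by move: up; rewrite pE -cat_cons cat_uniq => /andP[].
- by rewrite /= ltnS; apply: leq_trans leq_p1.
- by apply: leq_trans leq_p1 _; rewrite /= leqnSn.
Qed.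

Lemma j_connected_min_degree (G : graph) (j : nat) (x : G) :
  j_connected j G -> j <= #|[set y | adj x y]|.
Proof.
move=> conn; have lt_jG := proj1 conn.
have leX : j <= #|~: [set x]| by rewrite cardsC1; case: #|G| lt_jG.
apply: leq_trans (j_connected_linked conn leX (B := [set x]) _ _) _.
- by apply/set0Pn; exists x; rewrite inE.
- by rewrite disjoints_subset setCK.
apply: subset_leq_card; apply/subsetP=> y; rewrite !inE => /and3P[_ _].
by case/existsP=> z /andP[]; rewrite inE => /eqP->.
Qed.

Lemma longest_cycle (G : graph) (j : nat) : 2 <= j -> j_connected j G ->
  exists H : subgraph G, [/\ is_cycle H, j <= #|svert H|, unsplittable H (svert H),
                             no_isolated H & feet H = set0].
Proof.
move=> j2 conn; have /card_gt0P[x0 _] : 0 < #|G| by apply: leq_trans (proj1 conn).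
have mindeg x := j_connected_min_degree x conn.
pose P (A : {set G}) :=
  exists c, [/\ cycle (@adj G) c, uniq c, 2 < size c & A = [set y in c]].
have [c0 [cyc0 uc0 szc0 leq_c0]] := min_degree_cycle x0 j2 mindeg.
have [|A [c [cyc uc szc AE]] Amax] := ex_max_card (P := P) (A0 := [set y in c0]); first by exists c0.
exists (cycle_graph cyc); split.
- exact: cycle_graph_is_cycle.
- apply: leq_trans leq_c0 _; rewrite -(card_uniqP uc0) -[X in X <= _]cardsE /= -AE.
  by apply: Amax; exists c0.
- have aux x u : x \in c -> u \notin c -> adj x u -> adj u (next c x) -> False.
    move=> xc u_c xu ux; have [c' [cyc' uc' szc' c'E]] := cycle_insert cyc uc szc xc u_c xu ux.
    have := Amax [set y in c']; rewrite AE.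
    have -> : [set y in c'] = u |: [set y in c] by apply/setP=> z; rewrite !inE c'E inE.
    rewrite cardsU1 inE u_c ltnn => H; suff: false by []; apply: H.
    by exists c'; split=> //; apply/setP=> z; rewrite !inE c'E inE.
  move=> x y u /= /orP[] /andP[zc /eqP->]; rewrite inE => u_c xu; apply/negP=> uy.
    exact: aux zc u_c xu uy.
  by apply: (aux y u); rewrite // adj_sym.
- move=> x; rewrite /= inE => xc; exists (next c x).
  by rewrite /= /cycle_edge xc eqxx.
- exact: cycle_graph_feet.
Qed.

(** * Counting feet *)

(** The vertices of [F 0], ..., [F l.-1]. *)
Definition covered {G : graph} (F : nat -> subgraph G) (l : nat) : {set G} :=
  \bigcup_(i < l) svert (F i).

Lemma svert_covered (G : graph) (F : nat -> subgraph G) (i l : nat) :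
  i < l -> svert (F i) \subset covered F l.
Proof. by move=> lt_il; apply: (bigcup_max (Ordinal lt_il)). Qed.

Lemma coveredS (G : graph) (F : nat -> subgraph G) (l : nat) :
  covered F l.+1 = covered F l :|: svert (F l).
Proof. exact: big_ord_recr. Qed.

Lemma covered_mono (G : graph) (F : nat -> subgraph G) (k l : nat) :
  k <= l -> covered F k \subset covered F l.
Proof.
move=> le_kl; apply/bigcupsP=> i _; apply: svert_covered.
exact: leq_trans (ltn_ord i) le_kl.
Qed.

Lemma eq_covered (G : graph) (F F' : nat -> subgraph G) (l : nat) :
  (forall i, i < l -> F i = F' i) -> covered F l = covered F' l.
Proof. by move=> eqF; apply: eq_bigr => i _; rewrite eqF. Qed.

Lemma feet_svert (G : graph) (H : subgraph G) : feet H \subset svert H.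
Proof.
apply/subsetP=> x; rewrite inE => /cards1P[y /setP/(_ y)].
by rewrite !inE eqxx => /sedge_sub/and3P[].
Qed.

(** The properties of the [i]-th subgraph that bound the number of feet at a
vertex: no uncovered vertex can be inserted into one of its edges, it has no
isolated vertex, and each foot was covered before while the neighbour of the
foot was not. *)
Definition rigid {G : graph} (F : nat -> subgraph G) (i : nat) : Prop :=
  [/\ unsplittable (F i) (covered F i.+1), no_isolated (F i)
    & forall x y, sedge (F i) x y -> x \in feet (F i) ->
        x \in covered F i /\ y \notin covered F i].

Lemma foot_count (G : graph) (t m : nat) (F : nat -> subgraph G) (v : G) :
    2 <= t -> star_free t G -> v \in covered F m.+1 ->
    (forall i, i <= m -> rigid F i) ->
  #|[set i : 'I_m.+1 | v \in feet (F i)]| <= t - 2.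
Proof.
move=> t2 free /bigcupP[i1 _ vi1] rig.
have [i0 vi0 i0min] := arg_minnP (fun i : 'I_m.+1 => val i)
  (vi1 : (fun i : 'I_m.+1 => v \in svert (F i)) i1).
set K := [set i : 'I_m.+1 | _].
(* u i is a neighbour of v in F i, for i in K or i the index i0 of the first
   subgraph containing v. *)
pose u (i : 'I_m.+1) := odflt v [pick y | sedge (F i) v y].
have uP i : i \in i0 |: K -> sedge (F i) v (u i).
  move=> iK; have vi : v \in svert (F i).
    by case/setU1P: iK => [->//|]; rewrite inE; exact: (subsetP (feet_svert _)).
  have [_ noiso _] := rig i (ltn_ord i); have [y vy] := noiso v vi.
  by rewrite /u; case: pickP => // /(_ y); rewrite vy.
have late i : i \in K -> v \in covered F i /\ u i \notin covered F i.
  move=> iK; have [_ _ h] := rig i (ltn_ord i).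
  by apply: h; [apply: uP; rewrite inE iK orbT | rewrite inE in iK].
have lt_i0 i : i \in K -> i0 < i.
  case/late=> /bigcupP[k _ vk] _; apply: leq_ltn_trans (ltn_ord k).
  have lt_k : k < m.+1 by apply: ltn_trans (ltn_ord k) (ltn_ord i).
  exact: (i0min (Ordinal lt_k) vk).
have i0K : i0 \notin K by apply/negP=> /lt_i0; rewrite ltnn.
have indep_lt i k : i \in i0 |: K -> k \in i0 |: K -> i < k -> u i != u k /\ ~~ adj (u i) (u k).
  move=> iK kK lt_ik; have kK' : k \in K.
    case/setU1P: kK => // k0; case/setU1P: iK => [i0E|/lt_i0].
      by rewrite i0E k0 ltnn in lt_ik.
    by rewrite -k0 ltnNge ltnW.
  have [_ uk] := late k kK'; have vui := uP i iK; have vuk := uP k kK.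
  have [/(_ v (u i) (u k) vui) uns _ _] := rig i (ltn_ord i).
  have ui : u i \in covered F k.
    by apply: (subsetP (svert_covered _ lt_ik)); case/sedge_sub/and3P: vui.
  split; first by apply: contraNneq uk => <-.
  rewrite adj_sym; apply: uns; last by case/sedge_sub/and3P: vuk.
  by apply: contra uk; apply: (subsetP (covered_mono _ lt_ik)).
have indep i k : i \in i0 |: K -> k \in i0 |: K -> i != k -> u i != u k /\ ~~ adj (u i) (u k).
  move=> iK kK; rewrite neq_ltn => /orP[] lt; first exact: indep_lt.
  by rewrite eq_sym adj_sym; apply: indep_lt.
rewrite leqNgt; apply/negP => ltK; apply: free.
have leK : t <= #|i0 |: K| by rewrite cardsU1 i0K; move: ltK t2; clear; lia.
pose e (r : 'I_t) := enum_val (widen_ord leK r).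
have eK r : e r \in i0 |: K by apply: enum_valP.
have e_inj : injective e by move=> r s /enum_val_inj /(congr1 val) /= /val_inj.
have adj_vu r : adj v (u (e r)) by case/sedge_sub/and3P: (uP _ (eK r)).
have neq_vu r : v != u (e r).
  by apply: contraTneq (adj_vu r) => <-; rewrite adj_irrefl.
exists (fun x : complete_bipartite 1 t => match x with inl _ => v | inr r => u (e r) end).
  move=> [a|r] [b|s] //=.
  - by rewrite (ord1 a) (ord1 b).
  - by move/eqP; rewrite (negPf (neq_vu s)).
  - by move/eqP; rewrite eq_sym (negPf (neq_vu r)).
  move=> eq_u; congr inr; apply/e_inj/eqP/negPn/negP => ne.
  by have [] := indep _ _ (eK r) (eK s) ne; rewrite eq_u eqxx.
move=> [a|r] [b|s] /=.
- exact: adj_irrefl.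
- exact: adj_vu.
- by rewrite adj_sym adj_vu.
have [->|ne] := eqVneq r s; first exact: adj_irrefl.
by apply/negbTE; have [] := indep _ _ (eK r) (eK s); rewrite ?(inj_eq e_inj).
Qed.

(** * The decomposition *)

(** A partial decomposition [F 0], ..., [F m] whose branches belong to [R],
together with the invariant that allows it to be continued. *)
Record decomposition (j : nat) {G : graph} (R : {set G}) (m : nat)
    (F : nat -> subgraph G) : Prop := Decomposition {
  dec_cycle : is_cycle (F 0);
  dec_size : j <= #|svert (F 0)|;
  dec_spider : forall l, 1 <= l <= m -> exists v : G,
    [/\ v \in R, spider_from (F l) j v (covered F l)
      & 3 <= j -> forall u, is_branch (F l) u -> u = v];
  dec_rigid : forall i, i <= m -> rigid F i;
  dec_branch : R \subset covered F m.+1;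
  dec_feet : forall i, i <= m -> [disjoint feet (F i) & R];
  dec_linked : linked j R (covered F m.+1)
}.

Lemma decomposition_cycle (G : graph) (j : nat) : 2 <= j -> j_connected j G ->
  exists F : nat -> subgraph G, decomposition j set0 0 F.
Proof.
move=> j2 conn; have [H [cyc szH uns noiso nofeet]] := longest_cycle j2 conn.
have cov1 : covered (fun=> H) 1 = svert H by rewrite /covered big_ord1.
exists (fun=> H); split=> //.
- by case.
- case=> // _; split=> //; first by rewrite cov1.
  by move=> x y _; rewrite nofeet inE.
- exact: sub0set.
- by move=> i _; rewrite -setI_eq0 setI0.
- by rewrite cov1; apply: j_connected_linked.
Qed.

Lemma decomposition_step (G : graph) (j m : nat) (R : {set G})
    (F : nat -> subgraph G) :
    2 <= j -> decomposition j R m F -> covered F m.+1 != setT ->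
  exists (v : G) (F' : nat -> subgraph G),
    decomposition j (v |: R) m.+1 F' /\ covered F m.+1 \proper covered F' m.+2.
Proof.
move=> j2 [cyc szF sp rig RX ft link] XT; set X := covered F m.+1 in XT RX link *.
have leX : j <= #|X|.
  by apply: leq_trans szF _; apply/subset_leq_card/svert_covered.
have [v [H [[spH linkH ftH brH] [unsH noisoH fnH]]]] := spider_step j2 XT RX leX link.
pose F' i := if i == m.+1 then H else F i.
have F'E i : i <= m -> F' i = F i by rewrite /F' => le_im; rewrite ltn_eqF.
have F'm : F' m.+1 = H by rewrite /F' eqxx.
have covE l : l <= m.+1 -> covered F' l = covered F l.
  by move=> le_lm; apply: eq_covered => i lt_il; apply/F'E; exact: leq_trans lt_il le_lm.
have covm : covered F' m.+2 = X :|: svert H by rewrite coveredS covE // F'm.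
have [[vX _ [spiH _ _] brv] [ftX XS]] := spH.
have vH : v \in svert H.
  have : 0 < degree H v.
    by move: brv; rewrite /is_branch; case: existsP => _; [case: degree | move/eqP->].
  by case/card_gt0P=> y; rewrite inE => /sedge_sub/and3P[].
exists v, F'; split; last first.
  by rewrite covm properE subsetUl; apply/subsetPn; exists v; rewrite // inE vH orbT.
split.
- by rewrite F'E.
- by rewrite F'E.
- move=> l /andP[l_gt0]; rewrite leq_eqVlt => /orP[/eqP->|lt_lm].
    by exists v; rewrite F'm covE //; split=> //; exact: setU11.
  have [|w [wR spw brw]] := sp l; first by rewrite l_gt0.
  by exists w; rewrite F'E // covE; [split=> //; exact: setU1r | exact: ltnW].
- move=> i; rewrite leq_eqVlt => /orP[/eqP->|lt_im].
    split; rewrite F'm ?covm // => x y xy xf; rewrite covE //.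
    by split; [exact: subsetP ftX x xf | exact: fnH xy xf].
  by have := rig i lt_im; rewrite /rigid F'E // !covE // ltnW.
- by rewrite covm subUset sub1set inE vH orbT (subset_trans RX (subsetUl _ _)).
- move=> i; rewrite leq_eqVlt => /orP[/eqP->|lt_im].
    rewrite F'm -setI_eq0 setIUr setU_eq0 !setI_eq0 ftH andbT disjoint_sym disjoints1.
    by apply: contra vX => /(subsetP ftX).
  rewrite F'E // -setI_eq0 setIUr setU_eq0 !setI_eq0 ft // andbT disjoint_sym disjoints1.
  apply: contra vX => vf; apply: (subsetP (@svert_covered _ F i _ _)) => //.
  exact: (subsetP (feet_svert _) v vf).
- by rewrite covm.
Qed.

Lemma decomposition_complete (G : graph) (j m : nat) (R : {set G})
    (F : nat -> subgraph G) :
    2 <= j -> decomposition j R m F ->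
  exists R' m' F', decomposition j R' m' F' /\ covered F' m'.+1 = [set: G].
Proof.
move=> j2; have [n] := ubnP #|~: covered F m.+1|; elim: n m R F => // n IHn m R F ltn dec.
have [covT|/(decomposition_step j2 dec)] := eqVneq (covered F m.+1) setT.
  by exists R, m, F.
case=> v [F' [dec' ltF]]; apply: IHn dec'.
by move: ltn; rewrite ltnS; apply: leq_trans; rewrite proper_card // properC.
Qed.

Unset Implicit Arguments.

Theorem theorem2 (j t : nat) (G : graph) (hj : 2 <= j) (ht : 2 <= t)
    (Gconn : j_connected j G) (Gfree : star_free t G) :
  exists (m : nat) (F : nat -> subgraph G),
    [/\ is_cycle (F 0) /\ j <= #|svert (F 0)|,
        forall l, 1 <= l <= m ->
          exists v : G, spider_from (F l) j v (\bigcup_(i < l) svert (F i)),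
        [set: G] = \bigcup_(i < m.+1) svert (F i)
      & forall v : G,
          (3 <= j ->
           (exists2 l, 1 <= l <= m & is_branch (F l) v) ->
           forall i, i <= m -> v \notin feet (F i)) /\
          (j = 2 \/ ~ (exists2 l, 1 <= l <= m & is_branch (F l) v) ->
           #|[set i : 'I_m.+1 | v \in feet (F i)]| <= t - 2)].
Proof.
have [F0 dec0] := decomposition_cycle hj Gconn.
have [R [m [F [[cyc szF sp rig RX ft _] covT]]]] := decomposition_complete hj dec0.
exists m, F; split=> //.
  by move=> l /sp[v [_ spv _]]; exists v.
move=> v; split=> [j3 [l /sp[w [wR _ /(_ j3) brw]] /brw ->] i /ft dis|_].
  by rewrite (disjointFl dis).
by apply: foot_count; rewrite // covT inE.
Qed.
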